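(* The following is a family of valid inequalities for the TT-VS-DCA model, i.e. every feasible solution of the model satisfies $$\overline{\varsigma}^l_{k,i}-u_p\ \ge\ |\mathcal{T}|\left(\xi^{l}_{p,k}(w)-\xi^{l}_{p,k-1}(w)-1\right)$$ for all $w\in\mathcal{W}$, $p\in\mathcal{P}_w$, $k\in\mathcal{K}_l$, where $l=l_0\in\mathcal{L}_p$ is the first line of group $p$, $i=i^o_p$ is its origin stop, and $\overline{\varsigma}^l_{k,i}$ is the latest departure time of the MAV assigned to trip $k$ from stop $i$ of line $l$.
   Context: **Sets.** $\mathcal L$: finite set of bus lines. Line $l$ has stops $\mathcal S_l=\{1,\dots,|\mathcal S_l|\}$ in order of travel, partitioned into transfer stops $\mathcal R_l$ and non-transfer stops $\hat{\mathcal R}_l$, and trips $\mathcal K_l=\{1,\dots,|\mathcal K_l|\}$. $\dot{\mathcal A}$: set of transfer corridors $g=(l,i,l',i')$ with $l\neq l'$, $i\in\mathcal R_l$, $i'\in\mathcal R_{l'}$; $g'=(l',i',l,i)$ is the reverse corridor. $\mathcal M$: depots; $FL_m$ (resp. $LL_m$): lines starting (resp. ending) at depot $m$. $\mathcal T=\{1,\dots,|\mathcal T|\}$: time intervals of length $\Delta>0$. $\mathcal W$: finite set of scenarios with probabilities $\rho_w$. $\mathcal P_w$: passenger groups in scenario $w$; group $p$ has $n_p$ passengers, arrival time $u_p$ at its origin stop $i^o_p$, an ordered sequence of lines $\mathcal L_p=(l_0,l_1,\dots)$ and an ordered sequence $\mathcal R_p$ of transfer corridors linking consecutive lines. $\mathcal{PO}_i$,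 $\mathcal{PD}_i$: groups boarding / alighting at stop $i$ (of the line in question). $\mathcal Q=\{1,\dots,|\mathcal Q|\}$: possible numbers of modular units (MAUs) composing a modular vehicle (MAV); each trip is executed by one MAV. **Parameters.** $o^l_{k,1}$: originally scheduled arrival time of trip $k$ at the first stop of $l$; $r^l_{k,i}$: running time from stop $i$ to $i+1$; bounds $\alpha^{min}_{l,k}\le\alpha^{max}_{l,k}$ (shifting time), $\beta^{min}_{l,k,i}\le\beta^{max}_{l,k,i}$ (dwell time), $0\le h^l_{min}\le h^l_{max}$ (headway); $\underline\theta_g\le\overline\theta_g$: minimum/maximum transfer time; $t^{pre}_m$: preparation time at depot $m$; $\mathrm{CAP}$: capacity of one MAU; $\mathrm B$: number of available MAUs; $M_1,M_2,M_3$: big positive constants; $\epsilon_1,\epsilon_2$: tiny positive constants. **Variables.** Binary: $z^l_{k,i,t}$ ($=1$ iff trip $k$ on line $l$ has not yet departed from stop $i$ at time $t$), $\xi^l_{p,k}(w)$ ($=1$ iff group $p$ is able to board trip $k$ at its origin), $\chi^l_{p,k}(w)$, $\pi^g_{k,k'}$, $\zeta^g_{p,k,k'}(w)$, $e^g_{k,k'}$, $h^g_{k,k'}(w)$, $y^l_{k,i,q}(w)$. Nonnegative integers: $x^l_{k,i}(w)$ (number of MAUs of the MAV of trip $k$ between stops $i$ and $i+1$), $\kappa_m$. Dependent: $\alpha^l_{k,1},\beta^l_{k,i},a^l_{k,i},d^l_{k,i}$ (shift, dwell, arrival, departure times), $b,c,v$ (boarding, alighting, in-vehicle passengers), $AV_{m,t}(w),DV_{m,t}(w)$.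 Conventions: $\xi^l_{p,0}=0$, $\pi^g_{k,0}=0$, and $z^l_{k,i,t}=1$ for $t\le 0$. **Model (TT-VS-DCA).** A feasible solution is an assignment of all variables satisfying, for all relevant indices: Timetable: $z^l_{k,i,t+1}\le z^l_{k,i,t}$; $d^l_{k,i}=\Delta(1+\sum_{t\in\mathcal T}z^l_{k,i,t})$; $a^l_{k,1}=o^l_{k,1}+\alpha^l_{k,1}$ and $a^l_{k,i}=d^l_{k,i-1}+r^l_{k,i-1}$ for $i\ge2$; $\beta^l_{k,i}=d^l_{k,i}-a^l_{k,i}$; $\alpha^{min}_{l,k}\le\alpha^l_{k,1}\le\alpha^{max}_{l,k}$; $\beta^{min}_{l,k,i}\le\beta^l_{k,i}\le\beta^{max}_{l,k,i}$; $h^l_{min}\le d^l_{k+1,i}-d^l_{k,i}\le h^l_{max}$. Passengers: $M_1(\xi^l_{p,k}(w)-1)\le d^l_{k,i^o_p}-u_p\le M_1\xi^l_{p,k}(w)-\epsilon_1$ for $l=l_0\in\mathcal L_p$; $M_2(\pi^g_{k,k'}-1)\le d^{l'}_{k',i'}-a^l_{k,i}-\underline\theta_g\le M_2\pi^g_{k,k'}-\epsilon_2$ for $g=(l,i,l',i')$; $\zeta^g_{p,k,k'}(w)=\chi^l_{p,k}(w)(\pi^g_{k,k'}-\pi^g_{k,k'-1})$ for $g\in\mathcal R_p$; $\chi^l_{p,k}(w)=\xi^l_{p,k}(w)-\xi^l_{p,k-1}(w)$ if $l=l_0$, and $\chi^l_{p,k}(w)=\sum_{k'\in\mathcal K_{l'}}\zeta^g_{p,k',k}(w)$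 if $l\ne l_0$, with $g=(l',i',l,i)\in\mathcal R_p$; $b^l_{k,i}(w)=\sum_{p\in\mathcal{PO}_i}n_p\chi^l_{p,k}(w)$; $c^l_{k,i}(w)=\sum_{p\in\mathcal{PD}_i}n_p\chi^l_{p,k}(w)$; $v^l_{k,i}(w)=\sum_{j\le i}(b^l_{k,j}(w)-c^l_{k,j}(w))$; $v^l_{k,i}(w)\le \mathrm{CAP}\,x^l_{k,i}(w)$. Vehicle scheduling: $\sum_m\kappa_m\le \mathrm B$; $DV_{m,t}(w)\le\kappa_m+AV_{m,t}(w)$; $AV_{m,t}(w)=\sum_{l\in LL_m}\sum_{k\in\mathcal K_l}(1-z^l_{k,|\mathcal S_l|,t-t^{pre}_m})x^l_{k,|\mathcal S_l|}(w)$; $DV_{m,t}(w)=\sum_{l\in FL_m}\sum_{k\in\mathcal K_l}(1-z^l_{k,1,t})x^l_{k,1}(w)$. Capacity allocation: $e^g_{k,k'}=1$ if $\underline\theta_g\le d^{l'}_{k',i'}-a^l_{k,i}\le\overline\theta_g$ and $0$ otherwise; $h^g_{k,k'}(w)\le e^g_{k,k'}$; $h^g_{k,k'}(w)+h^{g'}_{k',k}(w)\le1$; $x^l_{k,i}(w)=\sum_{q\in\mathcal Q}q\,y^l_{k,i,q}(w)$; $x^l_{k,i-1}(w)=x^l_{k,i}(w)$ for $i\in\hat{\mathcal R}_l$ ($i\ge2$); for $i\in\mathcal R_l$: $x^l_{k,i}(w)-x^l_{k,i-1}(w)+1\le M_3(1-h^g_{k,k'}(w))$ and $x^l_{k,i}(w)=x^l_{k,i-1}(w)+\sum_{l'}\sum_{k'\in\mathcal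 K_{l'}}(h^{g'}_{k',k}(w)-h^g_{k,k'}(w))(x^{l'}_{k',i'-1}(w)-x^{l'}_{k',i'}(w))$, with $g=(l,i,l',i')$. **Latest departure times.** $\overline\varsigma^l_{k,i}=o^l_{k,1}+\alpha^{max}_{l,k}+\sum_{j=1}^{i}\beta^{max}_{l,k,j}+\sum_{j=1}^{i-1}r^l_{k,j}$. **Big-M convention.** $|\mathcal T|$ serves as a big-M constant for time differences (times are measured so that they lie in the horizon $[0,|\mathcal T|]$); in particular $u_p-\overline\varsigma^l_{k,i^o_p}\le|\mathcal T|$ for all $w\in\mathcal W$, $p\in\mathcal P_w$, $l=l_0$, $k\in\mathcal K_l$. *)

(* Defs.v *)
From HB Require Import structures.
From mathcomp Require Import all_boot all_order all_algebra.

Set Implicit Arguments.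
Unset Strict Implicit.
Unset Printing Implicit Defensive.

Import Order.TTheory GRing.Theory Num.Theory.
Local Open Scope ring_scope.

(** The model TT-VS-DCA (timetabling, vehicle scheduling and dynamic capacity
    allocation for modular vehicles), over an ordered field [R] of times.

    Trips, stops, time intervals and numbers of units are 1-based natural
    numbers restricted to their ranges by explicit side conditions, so that the
    conventions at index 0 ([xi_{p,0} = 0], [pi_{k,0} = 0]) can be written as
    they stand. *)

(** [(l, i, l', i')]: transfer from stop [i] of [l] to stop [i'] of [l']. *)
Definition corridor (L : Type) : Type := (L * nat * L * nat)%type.

Definition from_line L (g : corridor L) : L := g.1.1.1.
Definition to_line L (g : corridor L) : L := g.1.2.

Record instance (R : realFieldType) := Instance {
  line : finType;
  num_stops : line -> nat;
  is_transfer : line -> pred nat;   (* the complement: non-transfer stops *)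
  num_trips : line -> nat;
  corridors : pred (corridor line);
  depot : finType;
  lines_from : depot -> {set line};     (* FL_m *)
  lines_to : depot -> {set line};       (* LL_m *)
  num_intervals : nat;                  (* |T| *)
  Delta : R;
  scenario : finType;
  rho : scenario -> R;
  group : scenario -> finType;          (* P_w *)
  group_size : forall w, group w -> nat;            (* n_p *)
  arrival_time : forall w, group w -> R;            (* u_p *)
  origin_stop : forall w, group w -> nat;           (* i^o_p, on the first line *)
  destination_stop : forall w, group w -> nat;      (* on the last line *)
  (* the sequence of lines of [p] is [first_line p :: next_lines p] *)
  first_line : forall w, group w -> line;
  next_lines : forall w, group w -> seq line;
  group_corridors : forall w, group w -> seq (corridor line);   (* R_p *)
  max_units : nat;                      (* |Q| *)
  orig_time : line -> nat -> R;                     (* o^l_{k,1} *)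
  run_time : line -> nat -> nat -> R;               (* r^l_{k,i} *)
  alpha_min : line -> nat -> R;
  alpha_max : line -> nat -> R;
  beta_min : line -> nat -> nat -> R;
  beta_max : line -> nat -> nat -> R;
  headway_min : line -> R;
  headway_max : line -> R;
  theta_min : corridor line -> R;
  theta_max : corridor line -> R;
  prep_time : depot -> nat;             (* t^pre_m, in time intervals *)
  CAP : nat;
  num_units : nat;                      (* B *)
  M1 : R;
  M2 : R;
  M3 : R;
  eps1 : R;
  eps2 : R
}.

Arguments group_size {R i w} p : rename.
Arguments arrival_time {R i w} p : rename.
Arguments origin_stop {R i w} p : rename.
Arguments destination_stop {R i w} p : rename.
Arguments first_line {R i w} p : rename.
Arguments next_lines {R i w} p : rename.
Arguments group_corridors {R i w} p : rename.

Section Model.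
Variables (R : realFieldType) (I : instance R).

Definition is_stop (l : line I) (i : nat) : bool := (1 <= i <= num_stops l)%N.
Definition is_trip (l : line I) (k : nat) : bool := (1 <= k <= num_trips l)%N.
Definition is_interval (t : nat) : bool := (1 <= t <= num_intervals I)%N.

Definition last_line (w : scenario I) (p : group w) : line I :=
  last (first_line p) (next_lines p).

(** [PO_i] and [PD_i] for stop [i] of line [l]: a group boards at its origin and
    at the end of each of its corridors, and alights at the beginning of each of
    its corridors and at its destination. *)
Definition boarding (w : scenario I) (l : line I) (i : nat) : {set group w} :=
  [set p | ((l, i) == (first_line p, origin_stop p))
           || has (fun g => (g.1.2, g.2) == (l, i)) (group_corridors p)].

Definition alighting (w : scenario I) (l : line I) (i : nat) : {set group w} :=
  [set p | ((l, i) == (last_line p, destination_stop p))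
           || has (fun g => g.1.1 == (l, i)) (group_corridors p)].

(** The set of corridors need not be closed under reversal. *)
Record well_formed : Prop := WellFormed {
  wf_corridors : forall l i l' i', corridors (l, i, l', i') ->
    [/\ l != l', is_stop l i && is_transfer l i
      & is_stop l' i' && is_transfer l' i'];
  wf_Delta : 0 < Delta I;
  wf_rho_ge0 : forall w : scenario I, 0 <= rho w;
  wf_rho_sum : \sum_(w : scenario I) rho w = 1;
  wf_origin : forall w (p : group w), is_stop (first_line p) (origin_stop p);
  wf_destination : forall w (p : group w),
    is_stop (last_line p) (destination_stop p);
  wf_group_corridors : forall w (p : group w),
    all (@corridors _ I) (group_corridors p);
  (* the j-th corridor leads from the j-th line to the next one *)
  wf_links_from : forall w (p : group w),
    [seq from_line g | g <- @group_corridors R I w p] =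
    belast (first_line p) (next_lines p);
  wf_links_to : forall w (p : group w),
    [seq to_line g | g <- @group_corridors R I w p] = next_lines p;
  wf_alpha : forall (l : line I) k, is_trip l k -> alpha_min l k <= alpha_max l k;
  wf_beta : forall (l : line I) k i, is_trip l k -> is_stop l i ->
    beta_min l k i <= beta_max l k i;
  wf_headway : forall l : line I, 0 <= headway_min l <= headway_max l;
  wf_theta : forall g : corridor (line I), corridors g ->
    theta_min g <= theta_max g;
  wf_M : [/\ 0 < M1 I, 0 < M2 I & 0 < M3 I];
  wf_eps : 0 < eps1 I /\ 0 < eps2 I
}.

(** Latest departure time of trip [k] from stop [i] of line [l]. *)
Definition latest_departure (l : line I) (k i : nat) : R :=
  orig_time l k + alpha_max l k
  + \sum_(1 <= j < i.+1) beta_max l k j + \sum_(1 <= j < i) run_time l k j.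

(** An assignment of values to all the variables; binary ones are booleans. *)
Record assignment := Assignment {
  z : line I -> nat -> nat -> int -> bool;
  xi : forall w : scenario I, group w -> line I -> nat -> bool;
  chi : forall w : scenario I, group w -> line I -> nat -> bool;
  pi_ : corridor (line I) -> nat -> nat -> bool;
  zeta : forall w : scenario I, group w -> corridor (line I) -> nat -> nat -> bool;
  e : corridor (line I) -> nat -> nat -> bool;
  h : scenario I -> corridor (line I) -> nat -> nat -> bool;
  y : scenario I -> line I -> nat -> nat -> nat -> bool;
  x : scenario I -> line I -> nat -> nat -> nat;
  kappa : depot I -> nat;
  alpha : line I -> nat -> R;           (* alpha^l_{k,1} *)
  beta : line I -> nat -> nat -> R;
  arr : line I -> nat -> nat -> R;      (* a^l_{k,i} *)
  dep : line I -> nat -> nat -> R;      (* d^l_{k,i} *)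
  b : scenario I -> line I -> nat -> nat -> nat;
  c : scenario I -> line I -> nat -> nat -> nat;
  v : scenario I -> line I -> nat -> nat -> int;
  AV : scenario I -> depot I -> nat -> nat;
  DV : scenario I -> depot I -> nat -> nat
}.

Record conventions (s : assignment) : Prop := Conventions {
  z_nonpos : forall l k i (t : int), t <= 0 -> z s l k i t = true;
  xi_0 : forall w (p : group w) l, xi s p l 0 = false;
  pi_0 : forall g k, pi_ s g k 0 = false
}.

Record timetable (s : assignment) : Prop := Timetable {
  z_mono : forall l k i (t : nat), is_trip l k -> is_stop l i ->
    is_interval t -> is_interval t.+1 ->
    (z s l k i t.+1 <= z s l k i t)%N;
  dep_def : forall l k i, is_trip l k -> is_stop l i ->
    dep s l k i =
    Delta I * (1 + (\sum_(1 <= t < (num_intervals I).+1) z s l k i t)%:R);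
  arr_first : forall l k, is_trip l k ->
    arr s l k 1 = orig_time l k + alpha s l k;
  arr_next : forall l k i, is_trip l k -> is_stop l i -> (2 <= i)%N ->
    arr s l k i = dep s l k i.-1 + run_time l k i.-1;
  beta_def : forall l k i, is_trip l k -> is_stop l i ->
    beta s l k i = dep s l k i - arr s l k i;
  alpha_bounds : forall l k, is_trip l k ->
    alpha_min l k <= alpha s l k <= alpha_max l k;
  beta_bounds : forall l k i, is_trip l k -> is_stop l i ->
    beta_min l k i <= beta s l k i <= beta_max l k i;
  headway_bounds : forall l k i, is_trip l k -> is_trip l k.+1 -> is_stop l i ->
    headway_min l <= dep s l k.+1 i - dep s l k i <= headway_max l
}.

Record passengers (s : assignment) : Prop := Passengers {
  xi_bigM : forall w (p : group w) k, let l := first_line p in is_trip l k ->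
    M1 I * ((xi s p l k)%:R - 1)
      <= dep s l k (origin_stop p) - arrival_time p
      <= M1 I * (xi s p l k)%:R - eps1 I;
  pi_bigM : forall l i l' i' k k', let g := (l, i, l', i') in
    corridors g -> is_trip l k -> is_trip l' k' ->
    M2 I * ((pi_ s g k k')%:R - 1)
      <= dep s l' k' i' - arr s l k i - theta_min g
      <= M2 I * (pi_ s g k k')%:R - eps2 I;
  zeta_def : forall w (p : group w) l (i : nat) l' (i' : nat) k k', let g := (l, i, l', i') in
    g \in group_corridors p -> is_trip l k -> is_trip l' k' ->
    (zeta s p g k k')%:Z =
    (chi s p l k)%:Z * ((pi_ s g k k')%:Z - (pi_ s g k k'.-1)%:Z);
  chi_first : forall w (p : group w) k, let l := first_line p in is_trip l k ->
    (chi s p l k)%:Z = (xi s p l k)%:Z - (xi s p l k.-1)%:Z;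
  chi_next : forall w (p : group w) l' (i' : nat) l (i : nat) k, let g := (l', i', l, i) in
    g \in group_corridors p -> l != first_line p -> is_trip l k ->
    nat_of_bool (chi s p l k) =
    (\sum_(1 <= k' < (num_trips l').+1) zeta s p g k' k)%N;
  b_def : forall w l k i, is_trip l k -> is_stop l i ->
    b s w l k i = (\sum_(p in boarding w l i) group_size p * chi s p l k)%N;
  c_def : forall w l k i, is_trip l k -> is_stop l i ->
    c s w l k i = (\sum_(p in alighting w l i) group_size p * chi s p l k)%N;
  v_def : forall w l k i, is_trip l k -> is_stop l i ->
    v s w l k i = \sum_(1 <= j < i.+1) ((b s w l k j)%:Z - (c s w l k j)%:Z);
  v_capacity : forall w l k i, is_trip l k -> is_stop l i ->
    v s w l k i <= (CAP I * x s w l k i)%N%:Z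
}.

Record vehicle_scheduling (s : assignment) : Prop := VehicleScheduling {
  fleet_size : (\sum_(m : depot I) kappa s m <= num_units I)%N;
  fleet_balance : forall w m t, is_interval t ->
    (DV s w m t <= kappa s m + AV s w m t)%N;
  AV_def : forall w m t, is_interval t ->
    AV s w m t =
    (\sum_(l in lines_to m) \sum_(1 <= k < (num_trips l).+1)
       (1 - z s l k (num_stops l) (t%:Z - (prep_time m)%:Z)%R)
       * x s w l k (num_stops l))%N;
  DV_def : forall w m t, is_interval t ->
    DV s w m t =
    (\sum_(l in lines_from m) \sum_(1 <= k < (num_trips l).+1)
       (1 - z s l k 1 t) * x s w l k 1)%N
}.

(** At a transfer stop [i = 1] the index [i - 1] denotes the composition with
    which the vehicle reaches the first stop; it is not constrained further. *)
Record capacity_allocation (s : assignment) : Prop := CapacityAllocation {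
  e_def : forall l i l' i' k k', let g := (l, i, l', i') in
    corridors g -> is_trip l k -> is_trip l' k' ->
    e s g k k' = (theta_min g <= dep s l' k' i' - arr s l k i <= theta_max g);
  h_le_e : forall w l i l' i' k k', let g := (l, i, l', i') in
    corridors g -> is_trip l k -> is_trip l' k' ->
    (h s w g k k' <= e s g k k')%N;
  h_one_way : forall w l i l' i' k k',
    let g := (l, i, l', i') in let g' := (l', i', l, i) in
    corridors g -> is_trip l k -> is_trip l' k' ->
    (h s w g k k' + h s w g' k' k <= 1)%N;
  x_def : forall w l k i, is_trip l k -> is_stop l i ->
    x s w l k i = (\sum_(1 <= q < (max_units I).+1) q * y s w l k i q)%N;
  x_const : forall w l k i, is_trip l k -> is_stop l i ->
    ~~ is_transfer l i -> (2 <= i)%N ->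
    x s w l k i.-1 = x s w l k i;
  x_decrease : forall w l i l' i' k k', let g := (l, i, l', i') in
    corridors g -> is_trip l k -> is_trip l' k' ->
    (x s w l k i)%:R - (x s w l k i.-1)%:R + 1
      <= M3 I * (1 - (h s w g k k')%:R);
  x_exchange : forall w l k i, is_trip l k -> is_stop l i -> is_transfer l i ->
    (x s w l k i)%:Z =
    (x s w l k i.-1)%:Z +
    \sum_(l' : line I)
      \sum_(1 <= i' < (num_stops l').+1 | corridors (l, i, l', i'))
        \sum_(1 <= k' < (num_trips l').+1)
          ((h s w (l', i', l, i) k' k)%:Z - (h s w (l, i, l', i') k k')%:Z)
          * ((x s w l' k' i'.-1)%:Z - (x s w l' k' i')%:Z)
}.

Record feasible (s : assignment) : Prop := Feasible {
  feasible_conventions : conventions s;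
  feasible_timetable : timetable s;
  feasible_passengers : passengers s;
  feasible_scheduling : vehicle_scheduling s;
  feasible_capacity : capacity_allocation s
}.

(** [|T|] is a valid big-M constant for time differences. *)
Definition horizon_bigM : Prop :=
  forall (w : scenario I) (p : group w) (k : nat), is_trip (first_line p) k ->
    arrival_time p - latest_departure (first_line p) k (origin_stop p)
      <= (num_intervals I)%:R.

End Model.

(* Main.v *)
Require Import Defs.
From mathcomp Require Import all_boot all_order all_algebra.
From mathcomp Require Import ring lra.

Import Order.TTheory GRing.Theory Num.Theory.
Local Open Scope ring_scope.

(** Write [delta] for [xi_{p,k} - xi_{p,k-1}], which is at most 1.

    If [delta <= 0], the right-hand side is at most [- |T|], and the inequality
    follows from the big-M property of [|T|].  If [delta = 1], then [xi_{p,k} = 1] and the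
    right-hand side is 0: the left half of the boarding constraint says that
    trip [k] departs from the origin stop no earlier than [u_p]
    ([boarding_after_arrival]), and an actual departure is never later than the
    latest departure time ([dep_le_latest_departure]). *)

(** Departure times are accumulated along the line from the initial shift, the
    dwell times and the running times, and replacing shift and dwell times by
    their upper bounds turns this accumulation into [latest_departure]. *)
Lemma dep_le_latest_departure {R : realFieldType} {I : instance R}
    {s : assignment I} (tt : timetable s) {l : line I} {k i : nat} :
  is_trip l k -> is_stop l i -> dep s l k i <= latest_departure l k i.
Proof.
move=> hk; elim: i => [|[_|i IHi]] // hi.
- have := beta_def tt hk hi; rewrite (arr_first tt hk).
  have /andP[_ ] := beta_bounds tt hk hi; have /andP[_] := alpha_bounds tt hk.
  by rewrite /latest_departure big_nat1 big_geq //; lra.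
- have hi1 : is_stop l i.+1 by case/andP: hi => _ /ltnW.
  have := beta_def tt hk hi; rewrite (arr_next tt hk hi) //=.
  have -> : latest_departure l k i.+2 =
      latest_departure l k i.+1 + run_time l k i.+1 + beta_max l k i.+2.
    rewrite /latest_departure (big_nat_recr i.+2) //=.
    by rewrite [\sum_(1 <= j < i.+2) run_time l k j]big_nat_recr //=; ring.
  by have /andP[_] := beta_bounds tt hk hi; have := IHi hi1; lra.
Qed.

Lemma boarding_after_arrival {R : realFieldType} {I : instance R}
    {s : assignment I} (ps : passengers s) {w : scenario I} {p : group w}
    {k : nat} :
  is_trip (first_line p) k -> xi s p (first_line p) k ->
  arrival_time p <= dep s (first_line p) k (origin_stop p).
Proof.
move=> hk xik; have /andP[+ _] := xi_bigM ps hk.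
by rewrite xik subrr mulr0 subr_ge0.
Qed.

Theorem proposition2 (R : realFieldType) (I : instance R)
  (wfI : well_formed I) (bigM : horizon_bigM I)
  (s : assignment I) (fs : feasible s)
  (w : scenario I) (p : group w) (k : nat) (hk : is_trip (first_line p) k) :
  latest_departure (first_line p) k (origin_stop p) - arrival_time p >=
  (num_intervals I)%:R *
  ((xi s p (first_line p) k)%:R - (xi s p (first_line p) k.-1)%:R - 1).
Proof.
have [_ tt ps _ _] := fs.
have T_ge0 : 0 <= (num_intervals I)%:R :> R by rewrite ler0n.
have horizon := bigM w p k hk.
have dep_le := dep_le_latest_departure tt hk (wf_origin wfI p).
have := boarding_after_arrival ps hk.
case: (xi s p _ k) => [/(_ isT) arr_le | _]; case: (xi s p _ _) => /=; lra.
Qed.
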